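(* Let $m>0$. The Hessian matrix (with respect to $z\in\mathbb{R}^8$) of the function $\sqrt{2I}\,U$ at the point $z_0=\left(1,0,-\frac12,\frac{\sqrt3}{2},-\frac12,-\frac{\sqrt3}{2},0,0\right)$ has, counted with multiplicity, the eight eigenvalues $$0,\ 0,\ \lambda_3,\ \lambda_3,\ \lambda_4,\ \lambda_4,\ \lambda_5,\ \lambda_5,$$ where $\lambda_3,\lambda_4,\lambda_5$ are the three roots (with multiplicity) of the cubic equation $$\lambda^3-f_1(m)\lambda^2+f_2(m)\lambda-f_3(m)=0,$$ with $$f_1(m)=\frac12\left(2\sqrt3\,m^2+(9\sqrt3+2)m+5\right),$$ $$f_2(m)=\frac12\left(18m^3-18m^2+11\sqrt3\,m^2+15\sqrt3\,m+5m+3\right),$$ $$f_3(m)=-\frac{27\sqrt3\,m^3}{2}+\frac{21\sqrt3\,m^2}{4}-\frac{27m^2}{4}+\frac{3m}{2}+\frac{9\sqrt3\,m}{4}+\frac{45m^3}{4}.$$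
   Context: Consider the planar Newtonian 4-body problem with three masses equal to $1$ at positions $(x_i,y_i)\in\mathbb{R}^2$, $i=1,2,3$, and a fourth mass $m>0$ at position $(x_4,y_4)\in\mathbb{R}^2$. Write $z=(x_1,y_1,x_2,y_2,x_3,y_3,x_4,y_4)\in\mathbb{R}^8$, and let $$I(z)=\frac12\left(\sum_{i=1}^3(x_i^2+y_i^2)+m(x_4^2+y_4^2)\right),$$ $$U(z)=\sum_{1\le i<j\le 3}\frac{1}{\sqrt{(x_i-x_j)^2+(y_i-y_j)^2}}+m\sum_{i=1}^3\frac{1}{\sqrt{(x_i-x_4)^2+(y_i-y_4)^2}} .$$ The point $z_0$ (equilateral triangle with the fourth mass at its center) is a central configuration, i.e. a critical point of $\sqrt{2I}\,U$. The Hessian is the ordinary $8\times 8$ matrix of second partial derivatives $\partial^2(\sqrt{2I}\,U)/\partial z^2$. *)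

(* Defs.v *)
From HB Require Import structures.
From mathcomp Require Import all_boot all_order all_algebra.
From mathcomp Require Import all_classical all_reals all_analysis.

Set Implicit Arguments.
Unset Strict Implicit.
Unset Printing Implicit Defensive.

Import Order.TTheory GRing.Theory Num.Theory numFieldNormedType.Exports.

Local Open Scope ring_scope.

(* Bodies are numbered 0, 1, 2 (unit masses) and 3 (mass m); body k has
   coordinates z_(2k) and z_(2k+1), so that z = (x_1, y_1, ..., x_4, y_4). *)
Definition posx (R : realType) (z : 'rV[R]_8) (k : nat) : R :=
  z 0 (inord k.*2).

Definition posy (R : realType) (z : 'rV[R]_8) (k : nat) : R :=
  z 0 (inord k.*2.+1).

Definition dist_bodies (R : realType) (z : 'rV[R]_8) (i j : nat) : R :=
  Num.sqrt ((posx z i - posx z j) ^+ 2 + (posy z i - posy z j) ^+ 2).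

Definition inertia (R : realType) (m : R) (z : 'rV[R]_8) : R :=
  2^-1 * (\sum_(i < 3) (posx z i ^+ 2 + posy z i ^+ 2)
          + m * (posx z 3 ^+ 2 + posy z 3 ^+ 2)).

Definition potential (R : realType) (m : R) (z : 'rV[R]_8) : R :=
  \sum_(i < 3) \sum_(j < 3 | (i < j)%N) (dist_bodies z i j)^-1
  + m * \sum_(i < 3) (dist_bodies z i 3)^-1.

Definition sqrt2I_U (R : realType) (m : R) (z : 'rV[R]_8) : R :=
  Num.sqrt (2 * inertia m z) * potential m z.

Definition partial (R : realType) (n : nat) (f : 'rV[R]_n.+1 -> R)
    (i : 'I_n.+1) (z : 'rV[R]_n.+1) : R :=
  'D_(delta_mx 0 i) f z.

Definition hessian (R : realType) (n : nat) (f : 'rV[R]_n.+1 -> R)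
    (z : 'rV[R]_n.+1) : 'M[R]_n.+1 :=
  \matrix_(i, j) partial (partial f j) i z.

Definition z0 (R : realType) : 'rV[R]_8 :=
  \row_(k < 8) [:: 1; 0;
                   - 2^-1; Num.sqrt 3 / 2;
                   - 2^-1; - (Num.sqrt 3 / 2);
                   0; 0]`_k.

(* s lists all the roots of p, with multiplicity; it forces p != 0. *)
Definition roots_with_mult (R : realType) (p : {poly R}) (s : seq R) : Prop :=
  p != 0 /\ p = lead_coef p *: \prod_(x <- s) ('X - x%:P).

(* Algebraic multiplicity, which for a symmetric real matrix is also the
   geometric one. *)
Definition eigenvalues_with_mult (R : realType) (n : nat) (A : 'M[R]_n)
    (s : seq R) : Prop :=
  roots_with_mult (char_poly A) s.

Definition f1 (R : realType) (m : R) : R :=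
  2^-1 * (2 * Num.sqrt 3 * m ^+ 2 + (9 * Num.sqrt 3 + 2) * m + 5).

Definition f2 (R : realType) (m : R) : R :=
  2^-1 * (18 * m ^+ 3 - 18 * m ^+ 2 + 11 * Num.sqrt 3 * m ^+ 2
          + 15 * Num.sqrt 3 * m + 5 * m + 3).

Definition f3 (R : realType) (m : R) : R :=
  - (27 * Num.sqrt 3 * m ^+ 3 / 2) + 21 * Num.sqrt 3 * m ^+ 2 / 4
  - 27 * m ^+ 2 / 4 + 3 * m / 2 + 9 * Num.sqrt 3 * m / 4
  + 45 * m ^+ 3 / 4.

Definition cubic (R : realType) (m : R) : {poly R} :=
  'X^3 - f1 m *: 'X^2 + f2 m *: 'X - (f3 m)%:P.

(* Main.v *)
Require Import Defs.
From mathcomp Require Import all_boot all_order all_algebra.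
From mathcomp Require Import all_classical all_reals all_analysis.
From mathcomp Require Import complex ring.

Set Implicit Arguments.
Unset Strict Implicit.
Unset Printing Implicit Defensive.

Import Order.TTheory GRing.Theory Num.Theory numFieldNormedType.Exports.

Local Open Scope ring_scope.

(** The function sqrt(2I) U is built from square roots of positive quadratic
    forms: sqrt(2I) is the norm of the mass form and each distance is the
    (semi)norm of a separation form.  If N(z) = sqrt(q(z,z)), then
      D_v N = q(z,v) / N   and   D_v (1/N) = - q(z,v) / N^3,
    and differentiating once more uses only that q is bilinear.  Hence, away
    from collisions, the Hessian at z is the Gram matrix of an explicit
    symmetric bilinear form [objective_der2] in the coordinate basis
    ([hessianE]).

    At z0 this form collapses ([objective_der2_z0]), because in a central
    configuration the derivative of U is a multiple of the linear form
    v |-> mass_form(z0, v) ([potential_der_z0]).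

    The configuration is invariant under the symmetry group D_3 of the
    triangle.  As a representation of D_3, the space R^8 is the sum of the
    trivial line (scaling, spanned by z0), the sign line (rotation, spanned by
    z0 turned by a right angle), and three copies of the 2-dimensional
    irreducible representation.  By Schur's lemma the Hessian, written in an
    orthonormal basis adapted to this decomposition, is block diagonal with
    one scalar on each line and the same symmetric 3 x 3 block C twice; both
    scalars vanish, since sqrt(2I) U is invariant under scaling and rotation.
    Here the block form is verified directly by evaluating the bilinear form on
    the adapted basis ([hessian_adapted_basis]).  So the characteristic
    polynomial is X^2 char_poly(C)^2.  The polynomial char_poly(C) is the
    given cubic ([doublet_block_char_poly]), and it has three real roots
    because C is real symmetric ([real_symmetric_char_poly_split]). *)

(** * Characteristic polynomials *)

Lemma char_poly_conj (F : fieldType) n (P A B : 'M[F]_n) :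
  P \in unitmx -> P *m A = B *m P -> char_poly A = char_poly B.
Proof.
move=> Pu PA.
have Pd : \det (map_mx polyC P) != 0.
  by rewrite det_map_mx polyC_eq0 -unitfE -unitmxE.
apply: (mulfI Pd); rewrite /char_poly [RHS]mulrC -!det_mulmx.
congr (\det _); rewrite /char_poly_mx mulmxBr mulmxBl scalar_mxC.
by rewrite -!map_mxM PA.
Qed.

Lemma char_poly_block_diag (R : comNzRingType) m n (A : 'M[R]_m) (B : 'M[R]_n) :
  char_poly (block_mx A 0 0 B) = char_poly A * char_poly B.
Proof. by rewrite /char_poly char_block_diag_mx det_ublock. Qed.

(** Over the complex extension of R the matrix becomes Hermitian, hence
    unitarily diagonalizable with real eigenvalues; the factorization descends
    to R because the embedding of polynomials is injective. *)
Lemma real_symmetric_char_poly_split (R : rcfType) n (A : 'M[R]_n) :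
  A^T = A -> exists l : 'I_n -> R, char_poly A = \prod_(i < n) ('X - (l i)%:P).
Proof.
move=> Asym; pose iota := real_complex R.
pose Ac := map_mx iota A.
have Areal : Ac \is a realmx.
  by apply/mxOverP => i j; rewrite mxE complex_real.
have Aherm : Ac \is hermsymmx.
  apply: realsym_hermsym => //.
  by apply/is_hermitianmxP; rewrite expr0 scale1r map_mx_id // map_trmx Asym.
have /hermitian_normalmx/orthomx_spectralP := Aherm.
have /mxOverP sp_real := hermitian_spectral_diag_real Aherm.
set P := spectralmx Ac; set d := spectral_diag Ac => defA.
have Pu : P \in unitmx by exact: spectral_unit.
exists (fun i => complex.Re (d 0 i)).
have iotaRe i : iota (complex.Re (d 0 i)) = d 0 i.
  by rewrite /iota /= RRe_real // sp_real.
apply: (map_poly_inj iota).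
rewrite map_char_poly -/Ac (@char_poly_conj _ _ P _ (diag_mx d)) //; last first.
  by rewrite [in LHS]defA !mulmxA mulmxV // mul1mx.
rewrite char_poly_trig; last exact/diag_mx_is_trig.
rewrite rmorph_prod; apply: eq_bigr => i _.
by rewrite rmorphB /= map_polyX map_polyC /= mxE eqxx -iotaRe.
Qed.

Lemma det_mx2 (K : comNzRingType) (M : 'M[K]_2) :
  \det M = M 0 0 * M 1 1 - M 0 1 * M 1 0.
Proof.
rewrite (expand_det_row _ 0) !big_ord_recl big_ord0 /cofactor !det_mx11 !mxE /=.
rewrite expr0 expr1 mulN1r mul1r addr0 mulrN.
by do ?[congr (_ + _) | congr (- _) | congr (_ * _) | congr (M _ _)
      | apply: val_inj].
Qed.

Lemma det_mx3 (K : comNzRingType) (M : 'M[K]_3) :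
  \det M = M 0 0 * (M 1 1 * M 2 2 - M 1 2 * M 2 1)
         - M 0 1 * (M 1 0 * M 2 2 - M 1 2 * M 2 0)
         + M 0 2 * (M 1 0 * M 2 1 - M 1 1 * M 2 0).
Proof.
rewrite (expand_det_row _ 0) !big_ord_recl big_ord0 /cofactor !det_mx2 !mxE /=.
have l00 : lift (0 : 'I_3) (0 : 'I_2) = 1 by exact: val_inj.
have l01 : lift (0 : 'I_3) (1 : 'I_2) = 2 by exact: val_inj.
have l10 : lift (1 : 'I_3) (0 : 'I_2) = 0 by exact: val_inj.
have l11 : lift (1 : 'I_3) (1 : 'I_2) = 2 by exact: val_inj.
have l20 : lift (2 : 'I_3) (0 : 'I_2) = 0 by exact: val_inj.
have l21 : lift (2 : 'I_3) (1 : 'I_2) = 1 by exact: val_inj.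
have o2 : lift (0 : 'I_3) (lift (0 : 'I_2) (0 : 'I_1)) = 2 by exact: val_inj.
rewrite o2 !l00 !l01 !l10 !l11 !l20 !l21 /bump /=; ring.
Qed.

Lemma char_poly_mx3 (K : comNzRingType) (M : 'M[K]_3) :
  char_poly M = 'X^3 - (M 0 0 + M 1 1 + M 2 2) *: 'X^2
   + (M 0 0 * M 1 1 - M 0 1 * M 1 0 + (M 0 0 * M 2 2 - M 0 2 * M 2 0)
      + (M 1 1 * M 2 2 - M 1 2 * M 2 1)) *: 'X - (\det M)%:P.
Proof.
rewrite /char_poly !det_mx3 !mxE /= ?mulr1n ?mulr0n ?sub0r -!mul_polyC.
rewrite !(rmorphB, rmorphD, rmorphM) /=.
ring.
Qed.

Lemma roots_with_mult_prod (R : realType) (s : seq R) :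
  roots_with_mult (\prod_(x <- s) ('X - x%:P)) s.
Proof.
split; first exact/monic_neq0/monic_prod_XsubC.
by rewrite (monicP (monic_prod_XsubC s xpredT id)) scale1r.
Qed.

(** * Directional derivatives of norms of quadratic forms *)

Section Directional.
Context {R : realType} {V : normedModType R}.
Implicit Types (f g : V -> R) (z u v w : V).

(** Derivatives along v are derivatives in one real variable at 0, which
    gives access to the one-variable chain rule and to continuity along the
    line. *)
Lemma is_derive_line f z v df :
  is_derive z v f df <-> is_derive (0 : R) 1 (fun h : R => f (h *: v + z)) df.
Proof.
have E : (fun h : R => h^-1 *: (f (h *: v + z) - f z)) =
  (fun h : R => h^-1 *: (f ((h *: (1 : R) + 0) *: v + z) - f (0 *: v + z))).
  by apply/funext => h; rewrite scale0r add0r addr0 [_%:A]mulr1.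
split=> -[dv val]; split; move: dv val; rewrite /derivable /derive /=;
  rewrite E //.
Qed.

Lemma is_derive_comp_real (phi : R -> R) f z v dphi df :
  is_derive (f z) 1 phi dphi -> is_derive z v f df ->
  is_derive z v (fun x => phi (f x)) (dphi * df).
Proof.
move=> dphiP /is_derive_line dfP; apply/is_derive_line.
apply: (@is_derive1_comp _ phi (fun h : R => f (h *: v + z))).
by rewrite scale0r add0r.
Qed.

Lemma is_derive_mul f g z v df dg :
  is_derive z v f df -> is_derive z v g dg ->
  is_derive z v (fun x => f x * g x) (df * g z + f z * dg).
Proof.
move=> dfP dgP; apply: (is_derive_eq (is_deriveM dfP dgP)).
by rewrite /GRing.scale /= addrC; congr (_ + _); rewrite mulrC.
Qed.

Lemma is_derive_scale c f z v df :
  is_derive z v f df -> is_derive z v (fun x => c * f x) (c * df).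
Proof. by move=> dfP; exact: (is_deriveZ c dfP). Qed.

Lemma is_derive_big (I : eqType) (s : seq I) (F : I -> V -> R) (dF : I -> R) z v :
  (forall i, i \in s -> is_derive z v (F i) (dF i)) ->
  is_derive z v (fun x => \sum_(i <- s) F i x) (\sum_(i <- s) dF i).
Proof.
elim: s => [|i s IHs] dFP.
  have -> : (fun x => \sum_(i <- [::]) F i x) = cst 0.
    by apply/funext => x; rewrite big_nil.
  by rewrite big_nil; exact: is_derive_cst.
have -> : (fun x => \sum_(j <- i :: s) F j x) =
          F i + (fun x => \sum_(j <- s) F j x).
  by apply/funext => x; rewrite big_cons.
rewrite big_cons; apply: is_deriveD; first by apply: dFP; rewrite mem_head.
by apply: IHs => j js; apply: dFP; rewrite inE js orbT.
Qed.

Definition symmetric_bilinear (q : V -> V -> R) : Prop :=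
  (forall u v, q u v = q v u) /\
  (forall a u v w, q (a *: u + v) w = a * q u w + q v w).

Definition qnorm (q : V -> V -> R) z : R := Num.sqrt (q z z).

Section QuadraticForm.
Variable q : V -> V -> R.
Hypothesis qP : symmetric_bilinear q.

Lemma is_derive_form z v w : is_derive z v (q^~ w) (q v w).
Proof.
apply/is_derive_line.
pose p : {poly R} := q v w *: 'X + (q z w)%:P.
have -> : (fun h : R => q (h *: v + z) w) = horner p.
  by apply/funext => h; rewrite qP.2 /p !hornerE mulrC.
apply: is_derive_eq.
by rewrite /p derivD derivZ derivX derivC addr0 !hornerE.
Qed.

Lemma quad_line z v (h : R) :
  q (h *: v + z) (h *: v + z) = q v v * h ^+ 2 + (2 * q z v) * h + q z z.
Proof. by rewrite qP.2 ![q _ (_ + _)]qP.1 !qP.2 (qP.1 v z); ring. Qed.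

Lemma is_derive_quad z v : is_derive z v (fun x => q x x) (2 * q z v).
Proof.
apply/is_derive_line.
pose p : {poly R} := q v v *: 'X^2 + (2 * q z v) *: 'X + (q z z)%:P.
have -> : (fun h : R => q (h *: v + z) (h *: v + z)) = horner p.
  by apply/funext => h; rewrite quad_line /p !hornerE.
apply: is_derive_eq.
by rewrite /p !derivD !derivZ derivXn derivX derivC !hornerE; ring.
Qed.

(** Positivity persists along a line because q is a quadratic polynomial
    there; this makes first-derivative formulas valid near the point at
    which they are differentiated again. *)
Lemma near_line_form_gt0 z v : 0 < q z z ->
  \forall h \near (0 : R), 0 < q (h *: v + z) (h *: v + z).
Proof.
move=> qz; have /is_derive_line [dq _] := is_derive_quad z v.
have /derivable1_diffP/differentiable_continuous qc := dq.
by apply: (cvgr_gt _ qc); rewrite /= scale0r add0r.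
Qed.

Section Positive.
Variable z : V.
Hypothesis qz : 0 < q z z.

Lemma qnorm_gt0 : 0 < qnorm q z. Proof. by rewrite sqrtr_gt0. Qed.

Lemma is_derive_qnorm v : is_derive z v (qnorm q) (q z v / qnorm q z).
Proof.
apply: is_derive_eq.
  exact: is_derive_comp_real (is_derive1_sqrt qz) (is_derive_quad z v).
rewrite -/(qnorm q z); field.
by rewrite gt_eqF // qnorm_gt0.
Qed.

Lemma is_derive_qnormV v :
  is_derive z v (fun x => (qnorm q x)^-1) (- (q z v / qnorm q z ^+ 3)).
Proof.
have N0 : qnorm q z != 0 by rewrite gt_eqF // qnorm_gt0.
apply: is_derive_eq.
  apply: is_derive_comp_real (is_derive_qnorm v).
  exact: (@is_deriveV _ id).
by rewrite /= /GRing.scale /=; field.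
Qed.

Lemma is_derive_qnorm2 u v :
  is_derive z u (fun x => q x v / qnorm q x)
    (q u v / qnorm q z - q z v * q z u / qnorm q z ^+ 3).
Proof.
apply: is_derive_eq.
  exact: is_derive_mul (is_derive_form z u v) (is_derive_qnormV u).
by rewrite /=; ring.
Qed.

(** The cube is split into a product of reciprocals so that the second
    derivative of 1/N only needs the product rule and its first derivative. *)
Lemma is_derive_qnormV2 u v :
  is_derive z u (fun x => - (q x v / qnorm q x ^+ 3))
    (3 * q z v * q z u / qnorm q z ^+ 5 - q u v / qnorm q z ^+ 3).
Proof.
have N0 : qnorm q z != 0 by rewrite gt_eqF // qnorm_gt0.
have -> : (fun x => - (q x v / qnorm q x ^+ 3)) =
   (fun x => q x v * ((qnorm q x)^-1 * (- (qnorm q x)^-1 * (qnorm q x)^-1))).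
  by apply/funext => x; rewrite -exprVn; ring.
have dV := is_derive_qnormV u.
have dN := is_deriveN dV.
apply: is_derive_eq.
  exact: is_derive_mul (is_derive_form z u v)
    (is_derive_mul dV (is_derive_mul dN dV)).
by rewrite /= !fctE; field.
Qed.

End Positive.
End QuadraticForm.
End Directional.

(** A change of basis acts on Gram matrices by congruence: both sides expand
    b by bilinearity over the coordinates of two rows of P. *)
Lemma gram_change_basis (R : realType) n (b : 'rV[R]_n.+1 -> 'rV[R]_n.+1 -> R)
    (P : 'M[R]_n.+1) : symmetric_bilinear b ->
  P *m (\matrix_(i, j) b (delta_mx 0 i) (delta_mx 0 j)) *m P^T =
  \matrix_(i, j) b (row i P) (row j P).
Proof.
move=> [b_sym b_lin].
have b0 w : b 0 w = 0.
  by have := b_lin (-1) 0 0 w; rewrite scaler0 addr0 mulN1r addNr.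
have b_row u w : b u w = \sum_k u 0 k * b (delta_mx 0 k) w.
  rewrite {1}[u]row_sum_delta; elim/big_rec2: _ => [|k x y _ <-]; first exact: b0.
  exact: b_lin.
apply/matrixP => i j; rewrite !mxE b_sym b_row.
apply: eq_bigr => k _; rewrite !mxE [RHS]mulrC b_sym b_row; congr (_ * _).
by apply: eq_bigr => l _; rewrite !mxE.
Qed.

(** * The Hessian as a bilinear form *)

Section FourBody.
Variable R : realType.
Implicit Types (m : R) (z u v : 'rV[R]_8) (p : nat * nat).

(** The polar form of twice the moment of inertia. *)
Definition mass_form m u v : R :=
  \sum_(i < 3) (posx u i * posx v i + posy u i * posy v i)
  + m * (posx u 3 * posx v 3 + posy u 3 * posy v 3).

Definition sep_form p u v : R :=
  (posx u p.1 - posx u p.2) * (posx v p.1 - posx v p.2)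
  + (posy u p.1 - posy u p.2) * (posy v p.1 - posy v p.2).

Definition pairs : seq (nat * nat) :=
  [:: (0, 1); (0, 2); (1, 2); (0, 3); (1, 3); (2, 3)]%N.

(** Product of the masses of the two bodies; body 3 is always the second one
    of its pair. *)
Definition weight m p : R := if p.2 == 3%N then m else 1.

Lemma mass_formP m : symmetric_bilinear (mass_form m).
Proof.
split=> [u v|a u v w]; rewrite /mass_form !big_ord_recl !big_ord0.
  by ring.
by rewrite /posx /posy !mxE; ring.
Qed.

Lemma sep_formP p : symmetric_bilinear (sep_form p).
Proof.
split=> [u v|a u v w]; rewrite /sep_form; first by ring.
by rewrite /posx /posy !mxE; ring.
Qed.

Lemma sqrt_inertiaE m z : Num.sqrt (2 * inertia m z) = qnorm (mass_form m) z.
Proof.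
by rewrite /qnorm /inertia mulVKf ?pnatr_eq0 //.
Qed.

Lemma dist_bodiesE z i j : dist_bodies z i j = qnorm (sep_form (i, j)) z.
Proof. by rewrite /dist_bodies /qnorm /sep_form !expr2. Qed.

Lemma potentialE m z :
  potential m z = \sum_(p <- pairs) weight m p * (qnorm (sep_form p) z)^-1.
Proof.
rewrite /potential; under eq_bigr do rewrite big_mkcond /=.
rewrite !big_ord_recl !big_ord0 /= !dist_bodiesE /bump /= !addn0 !addr0 !add0r.
rewrite /pairs !big_cons big_nil /weight /=.
by rewrite -[(1 + 1)%N]/2%N; ring.
Qed.

Definition potential_der m z v : R :=
  \sum_(p <- pairs)
    weight m p * - (sep_form p z v / qnorm (sep_form p) z ^+ 3).

Definition potential_der2 m z u v : R :=
  \sum_(p <- pairs) weight m p *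
    (3 * sep_form p z v * sep_form p z u / qnorm (sep_form p) z ^+ 5
     - sep_form p u v / qnorm (sep_form p) z ^+ 3).

(** The domain where every square root involved has a positive argument, so
    that all factors are smooth. *)
Definition regular m z : Prop :=
  0 < mass_form m z z /\ forall p, p \in pairs -> 0 < sep_form p z z.

Lemma is_derive_potential m z v : regular m z ->
  is_derive z v (potential m) (potential_der m z v).
Proof.
move=> [_ sep0].
have -> : potential m = fun z =>
    \sum_(p <- pairs) weight m p * (qnorm (sep_form p) z)^-1.
  by apply/funext => x; exact: potentialE.
apply: is_derive_big => p /sep0 sp.
exact/is_derive_scale/is_derive_qnormV/sp/sep_formP.
Qed.

Lemma is_derive_potential_der m z u v : regular m z ->
  is_derive z u (fun x => potential_der m x v) (potential_der2 m z u v).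
Proof.
move=> [_ sep0]; apply: is_derive_big => p /sep0 sp.
exact/is_derive_scale/is_derive_qnormV2/sp/sep_formP.
Qed.

Definition objective_der m z v : R :=
  mass_form m z v / qnorm (mass_form m) z * potential m z
  + qnorm (mass_form m) z * potential_der m z v.

Definition objective_der2 m z u v : R :=
  let S := qnorm (mass_form m) z in
  (mass_form m u v / S - mass_form m z v * mass_form m z u / S ^+ 3)
    * potential m z
  + mass_form m z v / S * potential_der m z u
  + (mass_form m z u / S * potential_der m z v + S * potential_der2 m z u v).

Lemma is_derive_objective m z v : regular m z ->
  is_derive z v (sqrt2I_U m) (objective_der m z v).
Proof.
move=> rz; have [mz _] := rz.
have -> : sqrt2I_U m = fun z => qnorm (mass_form m) z * potential m z.
  by apply/funext => x; rewrite /sqrt2I_U sqrt_inertiaE.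
exact: is_derive_mul (is_derive_qnorm (mass_formP m) mz v)
  (is_derive_potential v rz).
Qed.

Lemma is_derive_objective_der m z u v : regular m z ->
  is_derive z u (fun x => objective_der m x v) (objective_der2 m z u v).
Proof.
move=> rz; have [mz _] := rz.
apply: is_deriveD.
  exact: is_derive_mul (is_derive_qnorm2 (mass_formP m) mz u v)
    (is_derive_potential u rz).
exact: is_derive_mul (is_derive_qnorm (mass_formP m) mz u)
  (is_derive_potential_der u v rz).
Qed.

(** A finite intersection of the neighborhoods of [near_line_form_gt0]. *)
Lemma near_line_regular m z u : regular m z ->
  \forall h \near (0 : R), regular m (h *: u + z).
Proof.
move=> [mz sep0].
have near_sep : forall s : seq (nat * nat), {subset s <= pairs} ->
    \forall h \near (0 : R), forall p, p \in s ->
      0 < sep_form p (h *: u + z) (h *: u + z).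
  elim=> [|p s IHs] sub; first by apply: filterE => h p; rewrite in_nil.
  have ps : p \in pairs by apply: sub; rewrite mem_head.
  have np := near_line_form_gt0 (sep_formP p) u (sep0 p ps).
  have nsv : {subset s <= pairs} by move=> x xs; apply: sub; rewrite inE xs orbT.
  have ns := IHs nsv.
  near=> h => p'; rewrite inE => /orP[/eqP ->|]; first by near: h.
  by move: p'; near: h.
have nm := near_line_form_gt0 (mass_formP m) u mz.
have ns := near_sep pairs (fun _ => id).
by near=> h; split; near: h.
Unshelve. all: by end_near. Qed.

(** The inner partial derivative is given by its formula on the whole part of
    the line near z that stays regular, so it may be replaced by this
    formula before the outer derivative is taken. *)
Lemma hessianE m z : regular m z ->
  hessian (sqrt2I_U m) z =
  \matrix_(i, j) objective_der2 m z (delta_mx 0 i) (delta_mx 0 j).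
Proof.
move=> rz; apply/matrixP => i j; rewrite !mxE /partial.
apply: derive_val; apply/is_derive_line.
have /is_derive_line := is_derive_objective_der (delta_mx 0 i) (delta_mx 0 j) rz.
apply: near_eq_is_derive.
have := near_line_regular (delta_mx 0 i) rz.
apply: filterS => h rh; apply/esym.
by apply: derive_val; apply: is_derive_objective.
Qed.

Lemma objective_der2P m z : symmetric_bilinear (objective_der2 m z).
Proof.
have [ms ml] := mass_formP m.
have ps u v : potential_der2 m z u v = potential_der2 m z v u.
  apply: eq_bigr => p _; have [s _] := sep_formP p.
  by rewrite (s u v); congr (_ * (_ - _)); ring.
have pl a u v : potential_der m z (a *: u + v) =
    a * potential_der m z u + potential_der m z v.
  rewrite mulr_sumr -big_split; apply: eq_bigr => p _ /=.
  by have [s l] := sep_formP p; rewrite ![sep_form p z _]s l; ring.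
have pll a u v w : potential_der2 m z (a *: u + v) w =
    a * potential_der2 m z u w + potential_der2 m z v w.
  rewrite mulr_sumr -big_split; apply: eq_bigr => p _ /=.
  by have [s l] := sep_formP p; rewrite ![sep_form p z _]s !l; ring.
split=> [u v|a u v w]; rewrite /objective_der2.
  by rewrite ps (ms u v); ring.
by rewrite !(ms z) !ml pl pll; ring.
Qed.

End FourBody.

(** * Evaluation at the central configuration *)

Section Evaluation.
Variables (R : realType) (m : R).
Local Notation s3 := (Num.sqrt 3 : R).

Definition vec8 (a : seq R) : 'rV[R]_8 := \row_(k < 8) a`_k.

Lemma posx_vec8 a k : (k < 4)%N -> posx (vec8 a) k = a`_k.*2.
Proof. by move=> k4; rewrite /posx mxE inordK //; move: k k4; do 4?case=> //. Qed.

Lemma posy_vec8 a k : (k < 4)%N -> posy (vec8 a) k = a`_k.*2.+1.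
Proof. by move=> k4; rewrite /posy mxE inordK //; move: k k4; do 4?case=> //. Qed.

Lemma mass_form_vec8 (a b : seq R) : mass_form m (vec8 a) (vec8 b) =
  a`_0 * b`_0 + a`_1 * b`_1 + a`_2 * b`_2 + a`_3 * b`_3 + a`_4 * b`_4
  + a`_5 * b`_5 + m * (a`_6 * b`_6 + a`_7 * b`_7).
Proof.
rewrite /mass_form !big_ord_recl big_ord0 !posx_vec8 // !posy_vec8 //=.
ring.
Qed.

Lemma sep_form_vec8 p (a b : seq R) : p \in pairs ->
  sep_form p (vec8 a) (vec8 b) =
  (a`_p.1.*2 - a`_p.2.*2) * (b`_p.1.*2 - b`_p.2.*2)
  + (a`_p.1.*2.+1 - a`_p.2.*2.+1) * (b`_p.1.*2.+1 - b`_p.2.*2.+1).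
Proof.
move=> pP; rewrite /sep_form !posx_vec8 ?posy_vec8 //;
  by move: pP; rewrite !inE => /or4P[| | |/or3P[]] => /eqP ->.
Qed.

Lemma sqr_s3 : s3 ^+ 2 = 3. Proof. by rewrite sqr_sqrtr. Qed.
Lemma s3_neq0 : s3 != 0. Proof. by rewrite gt_eqF // sqrtr_gt0. Qed.

Definition z0_coords : seq R :=
  [:: 1; 0; - 2^-1; s3 / 2; - 2^-1; - (s3 / 2); 0; 0].

Lemma mass_form_z0 : mass_form m (z0 R) (z0 R) = 3.
Proof.
rewrite -[z0 R]/(vec8 z0_coords) mass_form_vec8 /=.
by have s2 := sqr_s3; field: s2.
Qed.

Lemma sep_form_z0 p : p \in pairs ->
  sep_form p (z0 R) (z0 R) = if p.2 == 3%N then 1 else 3.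
Proof.
move=> pP; rewrite -[z0 R]/(vec8 z0_coords) sep_form_vec8 //.
have s2 := sqr_s3; move: pP.
by rewrite !inE => /or4P[| | |/or3P[]] => /eqP -> /=; field: s2.
Qed.

Lemma regular_z0 : regular m (z0 R).
Proof.
split=> [|p pP]; first by rewrite mass_form_z0.
by rewrite sep_form_z0 //; case: ifP.
Qed.

Lemma qnorm_sep_z0 p : p \in pairs ->
  qnorm (sep_form p) (z0 R) = if p.2 == 3%N then 1 else s3.
Proof.
by move=> pP; rewrite /qnorm sep_form_z0 //; case: ifP; rewrite ?sqrtr1.
Qed.

Lemma potential_z0 : potential m (z0 R) = s3 + 3 * m.
Proof.
have s2 := sqr_s3; have s0 := s3_neq0.
rewrite potentialE /pairs !big_cons big_nil !qnorm_sep_z0 // /weight /=.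
by field: s2.
Qed.

(** The central configuration equation: the gradient of U is proportional to
    the gradient of I, with factor - U / (2I) = - (s3 + 3 m) / 3. *)
Lemma potential_der_z0 (a : seq R) :
  potential_der m (z0 R) (vec8 a) =
  - ((1 + s3 * m) / s3) * mass_form m (z0 R) (vec8 a).
Proof.
have s2 := sqr_s3; have s0 := s3_neq0.
rewrite /potential_der /pairs !big_cons big_nil !qnorm_sep_z0 // /weight /=.
rewrite -[z0 R]/(vec8 z0_coords) mass_form_vec8 !sep_form_vec8 //=.
by field: s2.
Qed.

(** By [potential_der_z0] the mixed terms combine with the second derivative
    of sqrt(2I) into the rank-one correction to the mass form.  The factor
    1 + s3 m is U / sqrt(2I); a side has length s3 and a spoke has length 1,
    whence the coefficients 1/3 and s3 m of the tidal terms. *)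
Lemma objective_der2_z0 (a b : seq R) :
  objective_der2 m (z0 R) (vec8 a) (vec8 b) =
  (1 + s3 * m) * (mass_form m (vec8 a) (vec8 b)
    - mass_form m (z0 R) (vec8 a) * mass_form m (z0 R) (vec8 b))
  + \sum_(p <- pairs)
      (if p.2 == 3%N then
         s3 * m * (3 * sep_form p (z0 R) (vec8 a) * sep_form p (z0 R) (vec8 b)
                   - sep_form p (vec8 a) (vec8 b))
       else (sep_form p (z0 R) (vec8 a) * sep_form p (z0 R) (vec8 b)
             - sep_form p (vec8 a) (vec8 b)) / 3).
Proof.
have s2 := sqr_s3; have s0 := s3_neq0.
have -> : forall u v, objective_der2 m (z0 R) u v =
  (mass_form m u v / s3
   - mass_form m (z0 R) v * mass_form m (z0 R) u / s3 ^+ 3) * (s3 + 3 * m)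
  + mass_form m (z0 R) v / s3 * potential_der m (z0 R) u
  + (mass_form m (z0 R) u / s3 * potential_der m (z0 R) v
     + s3 * potential_der2 m (z0 R) u v).
  by move=> u v; rewrite /objective_der2 potential_z0 /qnorm mass_form_z0.
rewrite !potential_der_z0 /potential_der2 !big_cons !big_nil.
rewrite !qnorm_sep_z0 // /weight /=.
move: (mass_form m _ _) (mass_form m _ (vec8 a)) (mass_form m _ (vec8 b)) => x y z.
by field: s2.
Qed.

(** Identify the plane with the complex numbers, so that the outer bodies
    sit at the cube roots of unity w.  Up to normalization the displacements
    are: scaling (w on each outer body), rotation (i w), translation of the
    outer triangle (1), displacement of the central body (1), the quadrupole
    mode (w^2), and then the images i, i, - i w^2 of the last three.  Rows 2
    to 4 are even under complex conjugation and rows 5 to 7 are odd; the sign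
    of the last row makes the three pairs transform identically under
    D_3, so that both blocks coincide. *)
Definition basis_rows : seq (seq R) := let c := s3 / 3 in
  [:: [:: c; 0; - c / 2; 2^-1; - c / 2; - 2^-1; 0; 0];
      [:: 0; c; - 2^-1; - c / 2; 2^-1; - c / 2; 0; 0];
      [:: c; 0; c; 0; c; 0; 0; 0];
      [:: 0; 0; 0; 0; 0; 0; 1; 0];
      [:: c; 0; - c / 2; - 2^-1; - c / 2; 2^-1; 0; 0];
      [:: 0; c; 0; c; 0; c; 0; 0];
      [:: 0; 0; 0; 0; 0; 0; 0; 1];
      [:: 0; - c; - 2^-1; c / 2; 2^-1; c / 2; 0; 0]].

Definition adapted_basis : 'M[R]_8 := \matrix_(i < 8, j < 8) (nth [::] basis_rows i)`_j.

(** The Hessian on the even vectors of the three 2-dimensional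
    representations: outer translation, central body, quadrupole. *)
Definition block_rows : seq (seq R) :=
  [:: [:: 1 + 3 / 2 * s3 * m; - (3 / 2 * m); 3 / 2 * s3 * m];
      [:: - (3 / 2 * m); s3 * m ^+ 2 + (1 + 3 / 2 * s3) * m; - (9 / 2 * m)];
      [:: 3 / 2 * s3 * m; - (9 / 2 * m); 3 / 2 + 3 / 2 * s3 * m]].

Definition doublet_block : 'M[R]_3 := \matrix_(i < 3, j < 3) (nth [::] block_rows i)`_j.

Lemma adapted_basis_orthogonal : adapted_basis *m adapted_basis^T = 1%:M.
Proof.
have s2 := sqr_s3.
apply/matrixP => i j; rewrite !mxE !big_ord_recl big_ord0 !mxE.
by case: i => [[|[|[|[|[|[|[|[|//]]]]]]]] ?];
  case: j => [[|[|[|[|[|[|[|[|//]]]]]]]] ?] /=; field: s2.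
Qed.

Lemma row_adapted_basis i : row i adapted_basis = vec8 (nth [::] basis_rows i).
Proof. by apply/rowP => j; rewrite !mxE. Qed.

Lemma doublet_block_char_poly : char_poly doublet_block = cubic m.
Proof.
have s2 := sqr_s3.
rewrite char_poly_mx3 det_mx3 !mxE /= /cubic.
congr (_ - _ *: _ + _ *: _ - _%:P); rewrite /f1 /f2 /f3; by field: s2.
Qed.

Lemma hessian_adapted_basis :
  adapted_basis *m hessian (sqrt2I_U m) (z0 R) *m adapted_basis^T =
  block_mx (0 : 'M[R]_2) 0 0 (block_mx doublet_block 0 0 doublet_block).
Proof.
have s2 := sqr_s3.
rewrite hessianE; last exact: regular_z0.
rewrite gram_change_basis; last exact: objective_der2P.
have entry i j : objective_der2 m (z0 R) (row i adapted_basis) (row j adapted_basis)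
  = objective_der2 m (z0 R) (vec8 (nth [::] basis_rows i))
                            (vec8 (nth [::] basis_rows j)).
  by rewrite !row_adapted_basis.
apply/matrixP => i j; rewrite mxE entry objective_der2_z0.
rewrite -[z0 R]/(vec8 z0_coords) /pairs !big_cons big_nil /=.
rewrite !mass_form_vec8 !sep_form_vec8 //=.
(* Each index is split along the decomposition 8 = 2 + (3 + 3). *)
move: i j; change 8%N with (2 + (3 + 3))%N => i j.
case: (split_ordP i) => {}i ->; [|case: (split_ordP i) => {}i ->];
  (case: (split_ordP j) => {}j ->; [|case: (split_ordP j) => {}j ->]);
  rewrite ?(block_mxEul, block_mxEur, block_mxEdl, block_mxEdr) !mxE.
all: case: i => [[|[|[|//]]] //= ?]; case: j => [[|[|[|//]]] //= ?].
all: by field: s2.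
Qed.
End Evaluation.

Theorem mainTheorem2 (R : realType) (m : R) (hm : 0 < m) :
  exists l3 l4 l5 : R,
    roots_with_mult (cubic m) [:: l3; l4; l5] /\
    eigenvalues_with_mult (hessian (sqrt2I_U m) (z0 R))
      [:: 0; 0; l3; l3; l4; l4; l5; l5].
Proof.
have symC : trmx (doublet_block m) = doublet_block m.
  apply/matrixP => i j; rewrite !mxE.
  by case: i => [[|[|[|//]]] ?]; case: j => [[|[|[|//]]] ?].
have [l splitC] := real_symmetric_char_poly_split symC.
have cubicE : cubic m = \prod_(x <- [:: l 0; l 1; l 2]) ('X - x%:P).
  rewrite -doublet_block_char_poly splitC !big_ord_recl big_ord0 !big_cons big_nil.
  by do ?[congr (_ * _)]; congr ('X - (l _)%:P); apply: val_inj.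
exists (l 0), (l 1), (l 2); split.
  by rewrite cubicE; exact: roots_with_mult_prod.
have PPt := adapted_basis_orthogonal R.
have [Pu _] := mulmx1_unit PPt.
have PH : adapted_basis R *m hessian (sqrt2I_U m) (z0 R) =
    block_mx (0 : 'M[R]_2) 0 0 (block_mx (doublet_block m) 0 0 (doublet_block m))
    *m adapted_basis R.
  by rewrite -hessian_adapted_basis -[RHS]mulmxA (mulmx1C PPt) mulmx1.
have charH : char_poly (hessian (sqrt2I_U m) (z0 R)) =
    char_poly (0 : 'M[R]_2) * (cubic m * cubic m).
  rewrite -doublet_block_char_poly -!char_poly_block_diag.
  exact: char_poly_conj Pu PH.
rewrite /eigenvalues_with_mult charH char_poly_trig; last first.
  by apply/is_trig_mxP => i j _; rewrite mxE.
set p := (X in roots_with_mult X _).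
suff -> : p = \prod_(x <- [:: 0; 0; l 0; l 0; l 1; l 1; l 2; l 2]) ('X - x%:P).
  exact: roots_with_mult_prod.
rewrite /p cubicE !big_ord_recl big_ord0 !big_cons !big_nil !mxE.
ring.
Qed.
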